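(* Let $G$ be a bipartite graph, let $\langle A,B\rangle$ be an annihilating decomposition of $G$, and put $\mu=\mu(G)$ and $x=a(G)-\alpha(G)$. If $$x=2+\mu-2\sqrt{1+\mu},$$ then $1+\mu$ is a perfect square. Writing $q=\sqrt{1+\mu}$, one has $$\mu=q^2-1,\qquad x=(q-1)^2,\qquad |B|=2(q-1).$$ Moreover, $e(A)=e(B)=x$, $G[B]$ is the complete bipartite graph $K_{q-1,q-1}$, $G[A]$ is a matching of size $x$ together with isolated vertices, and $\alpha(G)=\alpha(G[A])$. Conversely, if a bipartite graph $G$ has an annihilating decomposition $\langle A,B\rangle$ satisfying, for some integer $q\geq 2$ and with $\mu=\mu(G)$, $x=a(G)-\alpha(G)$, all of these conditions (namely $\mu=q^2-1$, $x=(q-1)^2$, $|B|=2(q-1)$, $e(A)=e(B)=x$, $G[B]\cong K_{q-1,q-1}$, $G[A]$ a matching of size $x$ together with isolated vertices, and $\alpha(G)=\alpha(G[A])$), then $a(G)-\alpha(G)=2+\mu(G)-2\sqrt{1+\mu(G)}$.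
   Context: All graphs are finite, simple and undirected. For a graph $G$, $m(G)$ is the number of edges, $\alpha(G)$ is the independence number, $\mu(G)$ is the matching number, $G[X]$ is the subgraph induced by $X\subseteq V(G)$, and $e(X)$ is the number of edges of $G[X]$. A set $A\subseteq V(G)$ is annihilating if $\sum_{v\in A}d(v)\leq m(G)$; the annihilation number $a(G)$ is the maximum size of an annihilating set (equivalently, with degree sequence $d_1\leq\cdots\leq d_n$, $a(G)=\max\{k:\sum_{i=1}^k d_i\leq m(G)\}$). An annihilating decomposition of $G$ is a partition $\langle A,B\rangle$ of $V(G)$ such that $A$ is a maximum annihilating set (so $|A|=a(G)$) and $B=V(G)\setminus A$; a part may be empty, and $K_{0,0}$ denotes the graph with no vertices. ''A matching of size $x$ together with isolated vertices'' means a disjoint union of $x$ copies of $K_2$ and some number (possibly zero) of isolated vertices. *)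

(* Defs.v *)
From mathcomp Require Import all_boot all_order all_algebra.

Set Implicit Arguments.
Unset Strict Implicit.
Unset Printing Implicit Defensive.

(* Finite simple undirected graphs. *)
Record sgraph := SGraph {
  vertex :> finType;
  adj : rel vertex;
  adj_sym : symmetric adj;
  adj_irrefl : irreflexive adj }.
Arguments adj {_} _ _.

Definition isomorphic (G H : sgraph) : Prop :=
  exists2 f : G -> H, bijective f & forall x y, adj (f x) (f y) = adj x y.

Section GraphInvariants.
Variable G : sgraph.
Implicit Types (A B S : {set G}) (M : {set {set G}}).

Definition edges : {set {set G}} :=
  [set [set p.1; p.2] | p : G * G & adj p.1 p.2].

Definition size_graph : nat := #|edges|.

Definition degree (v : G) : nat := #|[set w : G | adj v w]|.

Definition independent S : bool :=
  [forall v in S, forall w in S, ~~ adj v w].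

Definition independence_number : nat := \max_(S | independent S) #|S|.

Definition is_matching M : bool := (M \subset edges) && trivIset M.

Definition matching_number : nat := \max_(M | is_matching M) #|M|.

Definition annihilating A : bool := \sum_(v in A) degree v <= size_graph.

Definition annihilation_number : nat := \max_(A | annihilating A) #|A|.

Definition annihilating_decomposition A B : Prop :=
  [/\ annihilating A, #|A| = annihilation_number & B = ~: A].

Definition bipartite : Prop :=
  exists X : {set G}, independent X && independent (~: X).

(* The induced subgraph G[S], on the vertex type of elements of S. *)
Section Induced.
Variable S : {set G}.
Definition induced_adj (u v : {x : G | x \in S}) : bool := adj (val u) (val v).
Fact induced_sym : symmetric induced_adj.
Proof. by move=> u v; apply: adj_sym. Qed.
Fact induced_irrefl : irreflexive induced_adj.
Proof. by move=> u; apply: adj_irrefl. Qed.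
Definition induced : sgraph := SGraph induced_sym induced_irrefl.
End Induced.

Lemma independent_annihilating S : independent S -> annihilating S.
Proof.
move=> /forall_inP indS; rewrite /annihilating /size_graph.
pose D := [set p : G * G | (p.1 \in S) && adj p.1 p.2].
have -> : \sum_(v in S) degree v = #|D|.
  rewrite -sum1dep_card -(pair_big_dep (mem S) (fun v w => adj v w)
    (fun _ _ => 1)) /=.
  by apply: eq_bigr => v _; rewrite /degree -sum1dep_card.
rewrite -(card_in_imset (f := fun p : G * G => [set p.1; p.2])); last first.
  move=> [a b] [c d]; rewrite !inE /= => /andP[aS ab] /andP[cS cd] E.
  have nS x y : x \in S -> adj x y -> y \notin S.
    by move=> xS xy; apply/negP => yS; have /forall_inP/(_ y yS) := indS x xS; rewrite xy.
  have : a \in [set c; d] by rewrite -E set21.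
  have : b \in [set c; d] by rewrite -E set22.
  have bS := nS _ _ aS ab; have dS := nS _ _ cS cd.
  rewrite !inE => /orP[]/eqP eb /orP[]/eqP ea; subst => //.
  - by rewrite cS in bS.
  - by rewrite cS in bS.
  - by rewrite aS in dS.
apply/subset_leq_card/subsetP => E /imsetP[p]; rewrite inE => /andP[_ ap] ->.
by apply: imset_f; rewrite inE.
Qed.

Lemma independence_le_annihilation :
  independence_number <= annihilation_number.
Proof.
apply/bigmax_leqP => S /independent_annihilating annS.
exact: (bigmax_sup S).
Qed.

(* The quantity a(G) - alpha(G); by independence_le_annihilation the truncated
   subtraction of natural numbers is the true one. *)
Definition annihilation_gap : nat := annihilation_number - independence_number.

End GraphInvariants.

Definition complete_bipartite_adj m n (u v : 'I_m + 'I_n) : bool :=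
  match u, v with
  | inl _, inr _ | inr _, inl _ => true
  | _, _ => false
  end.
Fact complete_bipartite_sym m n : symmetric (@complete_bipartite_adj m n).
Proof. by case=> [i|i] [j|j]. Qed.
Fact complete_bipartite_irrefl m n :
  irreflexive (@complete_bipartite_adj m n).
Proof. by case. Qed.
Definition complete_bipartite m n : sgraph :=
  SGraph (@complete_bipartite_sym m n) (@complete_bipartite_irrefl m n).

(* The disjoint union of s copies of K_2 and k isolated vertices; the ends of
   the i-th edge are inl (i, false) and inl (i, true). *)
Definition matching_isolated_adj s k (u v : 'I_s * bool + 'I_k) : bool :=
  match u, v with
  | inl (i, b), inl (j, c) => (i == j) && (b != c)
  | _, _ => false
  end.
Fact matching_isolated_sym s k : symmetric (@matching_isolated_adj s k).
Proof. by case=> [[i b]|i] [[j c]|j] //=; rewrite eq_sym (eq_sym b). Qed.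
Fact matching_isolated_irrefl s k : irreflexive (@matching_isolated_adj s k).
Proof. by case=> [[i b]|i] //=; rewrite !eqxx. Qed.
Definition matching_isolated s k : sgraph :=
  SGraph (@matching_isolated_sym s k) (@matching_isolated_irrefl s k).

(* Only used for q >= 1, so that q ^ 2 - 1 and q - 1 are not truncated. *)
Definition extremal_structure (G : sgraph) (A B : {set G}) (q : nat) : Prop :=
  let x := annihilation_gap G in
  [/\ matching_number G = q ^ 2 - 1, x = (q - 1) ^ 2 & #|B| = 2 * (q - 1)] /\
  [/\ size_graph (induced A) = x,
      size_graph (induced B) = x,
      isomorphic (induced B) (complete_bipartite (q - 1) (q - 1)),
      exists k, isomorphic (induced A) (matching_isolated x k)
    & independence_number G = independence_number (induced A)].

Definition extremal_equation (R : rcfType) (G : sgraph) : Prop :=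
  ((annihilation_number G)%:R - (independence_number G)%:R
   = 2 + (matching_number G)%:R
     - 2 * Num.sqrt (1 + (matching_number G)%:R) :> R)%R.

(* Main.v *)
(* Write b, c for the sizes of the two colour classes of G[B].  Comparing degree
   sums gives e(A) <= e(B), and deleting one end of every edge of G[A] leaves an
   independent set, so
     x = |A| - alpha(G) <= |A| - alpha(G[A]) <= e(A) <= e(B) <= b c,
   while b + c = |B| = n - alpha(G) - x <= mu - x by Konig's theorem.  The
   equation on x amounts to 4 x = (mu - x)^2, so (b + c)^2 <= 4 x <= 4 b c forces
   equality everywhere; the structure of G[A] and G[B] is read off from the
   equality cases. *)

Require Import Defs.
From mathcomp Require Import all_boot all_order all_algebra zify lra ring.

Set Implicit Arguments.
Unset Strict Implicit.
Unset Printing Implicit Defensive.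

Import GRing.Theory Num.Theory.

(** * Konig's theorem for bipartite graphs given as sets of pairs *)

Definition vertex_cover (T U : finType) (E : {set T * U})
    (C : {set T} * {set U}) : bool :=
  [forall p in E, (p.1 \in C.1) || (p.2 \in C.2)].

Lemma vertex_coverP (T U : finType) (E : {set T * U})
    (C : {set T} * {set U}) :
  reflect (forall x y, (x, y) \in E -> (x \in C.1) || (y \in C.2))
          (vertex_cover E C).
Proof.
apply: (iffP forall_inP) => [H x y xy|H [x y] xy]; first exact: (H _ xy).
exact: H.
Qed.

(* Lovasz: if xy and xz are distinct edges, take covers C, D of size < t of the
   graphs without xy, resp. xz.  Meeting them on one side and joining them on the
   other gives the cover m1, and the opposite choice becomes a cover m2 once x is
   added; their sizes add up to at most |C| + |D| + 1 < 2 t. *)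
Lemma cover_critical_fst_inj (T U : finType) (E : {set T * U}) (t : nat) :
  (forall C, vertex_cover E C -> t <= #|C.1| + #|C.2|) ->
  (forall e, e \in E ->
     exists2 C, vertex_cover (E :\ e) C & #|C.1| + #|C.2| < t) ->
  {in E &, injective fst}.
Proof.
move=> t_min crit [x y] [x' z] Ee Ef /= exx; subst x'.
have [//|ne] := eqVneq (x, y) (x, z).
have [[C1 C2] /vertex_coverP/= cC ltC] := crit _ Ee.
have [[D1 D2] /vertex_coverP/= cD ltD] := crit _ Ef.
have covC a b : (a, b) \in E -> (a, b) != (x, y) -> (a \in C1) || (b \in C2).
  by move=> abE abe; apply: cC; rewrite !inE abe.
have covD a b : (a, b) \in E -> (a, b) != (x, z) -> (a \in D1) || (b \in D2).
  by move=> abE abe; apply: cD; rewrite !inE abe.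
have full1 : x \notin C1.
  apply/negP => xC; have := t_min (C1, C2); rewrite leqNgt ltC => /(_ _)/negP[] //.
  apply/vertex_coverP => a b abE /=; have [[-> _]|] := eqVneq (a, b) (x, y).
    by rewrite xC.
  exact: covC.
have full2 : x \notin D1.
  apply/negP => xC; have := t_min (D1, D2); rewrite leqNgt ltD => /(_ _)/negP[] //.
  apply/vertex_coverP => a b abE /=; have [[-> _]|] := eqVneq (a, b) (x, z).
    by rewrite xC.
  exact: covD.
have zC : z \in C2 by have := covC _ _ Ef; rewrite eq_sym ne (negPf full1); apply.
have yD : y \in D2 by have := covD _ _ Ee; rewrite ne (negPf full2); apply.
have m1 : t <= #|C1 :&: D1| + #|C2 :|: D2|.
  apply: (t_min (_, _)); apply/vertex_coverP => a b abE; rewrite !inE /=.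
  have [[-> ->]|/(covC _ _ abE)] := eqVneq (a, b) (x, y); first by rewrite yD !orbT.
  have [[-> ->]|/(covD _ _ abE)] := eqVneq (a, b) (x, z); first by rewrite zC !orbT.
  by do 2!case/orP=> ->; rewrite ?orbT.
have m2 : t <= #|x |: (C1 :|: D1)| + #|C2 :&: D2|.
  apply: (t_min (_, _)); apply/vertex_coverP => a b abE; rewrite !inE /=.
  have [[-> ->]|/(covC _ _ abE)] := eqVneq (a, b) (x, y); first by rewrite eqxx.
  have [[-> ->]|/(covD _ _ abE)] := eqVneq (a, b) (x, z); first by rewrite eqxx.
  by do 2!case/orP=> ->; rewrite ?orbT.
rewrite cardsU1 !inE (negPf full1) (negPf full2) /= in m2.
have := cardsUI C1 D1; have := cardsUI C2 D2; simpl in *; lia.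
Qed.

(** Induction on the number of edges. If deleting any edge lowers the covering number, [E] is itself
    a matching; otherwise delete an edge that does not lower it, and the matching found in the rest
    is already large enough. *)
Theorem konig (T U : finType) (E : {set T * U}) :
  exists (M : {set T * U}) (C : {set T} * {set U}),
    [/\ M \subset E, {in M &, injective fst}, {in M &, injective snd},
        vertex_cover E C & #|C.1| + #|C.2| <= #|M|].
Proof.
have [n] := ubnP #|E|; elim: n E => // n IHn E ltEn.
have cov0 : vertex_cover E (setT, setT) by apply/vertex_coverP => *; rewrite inE.
case: (arg_minnP (fun C : {set T} * {set U} => #|C.1| + #|C.2|) cov0) => C covC minC.
have [/forall_inP crit|] := boolP [forall e in E,
    [exists D, vertex_cover (E :\ e) D && (#|D.1| + #|D.2| < #|C.1| + #|C.2|)]].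
  exists E, C; split=> //.
  - apply: (cover_critical_fst_inj minC) => e /crit/existsP[D /andP[]].
    by exists D.
  (* Criticality is symmetric in the two sides, so the second projection is handled by transposing
     [E]. *)
  - pose E' : {set U * T} := [set p | (p.2, p.1) \in E].
    have fst_inj : {in E' &, injective fst}.
      apply: (@cover_critical_fst_inj _ _ _ (#|C.1| + #|C.2|)) => [D covD|[y x]].
        rewrite [leqRHS]addnC; apply: (minC (D.2, D.1)); apply/vertex_coverP => x y xy /=.
        by rewrite orbC; move/vertex_coverP: covD; apply; rewrite inE.
      rewrite inE /= => /crit/existsP[D /andP[/vertex_coverP covD ltD]].
      exists (D.2, D.1); last by rewrite addnC.
      apply/vertex_coverP => y' x'; rewrite !inE /= => /andP[ne xyE].
      rewrite orbC; apply: covD; rewrite !inE xyE andbT.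
      by apply: contra_neq ne => -[-> ->].
    move=> [x y] [x' y'] xyE xyE' /= eyy; rewrite eyy in xyE *.
    by have [] : (y', x) = (y', x') by [apply: fst_inj; rewrite ?inE]; move=> ->.
  (* The first ends of all edges form a cover, so a minimum cover has at most [#|E|] vertices. *)
  - apply: leq_trans (minC ([set p.1 | p in E], set0) _) _.
      by apply/vertex_coverP => x y xy /=; rewrite (imset_f fst xy).
    by rewrite /= cards0 addn0 leq_imset_card.
case/forall_inPn => e eE /existsPn noD.
have [|M [D [ME M1 M2 covD leD]]] := IHn (E :\ e).
  by rewrite (cardsD1 e) eE in ltEn.
exists M, C; split=> //; first exact: subset_trans ME (subsetDl _ _).
by have := noD D; rewrite covD /= -leqNgt => /leq_trans->.
Qed.

(** Explicit maps are easier to define on the model graph [H], whereas [isomorphic] asks for a map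
    out of [G]; choosing preimages inverts them. *)
Lemma isomorphic_of_parametrization (G H : sgraph) (g : H -> G) :
  injective g -> (forall v, exists u, g u == v) ->
  (forall u u', adj (g u) (g u') = adj u u') -> isomorphic G H.
Proof.
move=> g_inj g_surj g_adj; pose f v := xchoose (g_surj v).
have fK : cancel f g by move=> v; apply/eqP/(xchooseP (g_surj v)).
exists f; last by move=> v w; rewrite -g_adj !fK.
by exists g => // u; apply: g_inj; rewrite fK.
Qed.

(** * Orientations and edge counting *)

Section Orientation.
Variable G : sgraph.
Implicit Types (O : {set G * G}) (S X : {set G}) (v w : G).

(** Choosing one ordered pair per edge replaces counts of two-element sets by counts of pairs. The
    sum of booleans excludes choosing both directions. *)
Definition orientation O : Prop :=
  forall v w, adj v w = ((v, w) \in O) + ((w, v) \in O) :> nat.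

Lemma orientation_adj O v w : orientation O -> (v, w) \in O -> adj v w.
Proof. by move=> /(_ v w); case: (adj v w); do 2!case: (_ \in _). Qed.

Lemma adj_orientation O v w :
  orientation O -> adj v w -> ((v, w) \in O) || ((w, v) \in O).
Proof. by move=> /(_ v w); case: (adj v w); do 2!case: (_ \in _). Qed.

Lemma orientation_antisym O v w :
  orientation O -> (v, w) \in O -> (w, v) \in O = false.
Proof. by move=> /(_ v w); case: (adj v w); do 2!case: (_ \in _). Qed.

Lemma orientation_exists : exists O, orientation O.
Proof.
exists [set p : G * G | adj p.1 p.2 && (enum_rank p.1 < enum_rank p.2)] => v w.
rewrite !inE /= (adj_sym w v); case vw: (adj v w) => //=.
have: enum_rank v != enum_rank w :> nat.
  by apply: contraTneq vw => /ord_inj/enum_rank_inj->; rewrite adj_irrefl.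
by case: ltngtP.
Qed.

Lemma size_graph_orientation O : orientation O -> size_graph G = #|O|.
Proof.
move=> oriO; rewrite -(card_in_imset (f := fun p : G * G => [set p.1; p.2])).
  congr #|pred_of_set _|; apply/setP => e; apply/imsetP/imsetP => -[[v w]].
    rewrite inE /= => /(adj_orientation oriO)/orP[vw ->|wv ->].
      by exists (v, w).
    by exists (w, v); rewrite //= setUC.
  by move=> vw ->; exists (v, w) => //; rewrite inE /=; apply: orientation_adj vw.
move=> [v w] [v' w'] vw vw' /= E.
have vNw a b : (a, b) \in O -> a != b.
  by move/(orientation_adj oriO); apply: contraTneq => ->; rewrite adj_irrefl.
have: v \in [set v'; w'] by rewrite -E set21.
have: w \in [set v'; w'] by rewrite -E set22.
rewrite !inE => /orP[]/eqP ew /orP[]/eqP ev; subst w v => //.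
- by have:= vNw _ _ vw; rewrite eqxx.
- by rewrite (orientation_antisym oriO vw') in vw.
- by have:= vNw _ _ vw; rewrite eqxx.
Qed.

Lemma handshake : \sum_(v : G) \sum_(w : G) adj v w = 2 * size_graph G.
Proof.
have [O oriO] := orientation_exists; rewrite (size_graph_orientation oriO).
have sumO : \sum_(v : G) \sum_(w : G) ((v, w) \in O) = #|O|.
  rewrite pair_bigA /= -sum1_card [RHS]big_mkcond /=.
  by apply: eq_bigr => -[v w] _; case: ((v, w) \in O).
under eq_bigr => v _ do (under eq_bigr => w _ do rewrite (oriO v w); rewrite big_split).
by rewrite big_split /= sumO exchange_big /= sumO mul2n addnn.
Qed.

(** The complement of a hitting set is independent. This serves both for one chosen end per edge and
    for Konig covers. *)
Lemma order_le_independence_hitting S :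
  (forall v w, adj v w -> (v \in S) || (w \in S)) ->
  #|G| <= independence_number G + #|S|.
Proof.
move=> hitS; rewrite -(cardsC S) addnC leq_add2r.
apply: (bigmax_sup (~: S)) => //.
apply/forall_inP => v; rewrite inE => vS; apply/forall_inP => w; rewrite inE => wS.
by apply/negP => /hitS; rewrite (negPf vS) (negPf wS).
Qed.

Lemma order_le_independence_size :
  #|G| <= independence_number G + size_graph G.
Proof.
have [O oriO] := orientation_exists; rewrite (size_graph_orientation oriO).
apply: leq_trans (leq_add (leqnn _) (leq_imset_card fst O)).
apply: order_le_independence_hitting => v w /(adj_orientation oriO).
by case/orP=> /(imset_f fst) ->; rewrite ?orbT.
Qed.

(* If a vertex had two neighbours, one vertex chosen from each edge, with
   that vertex chosen twice, would hit all edges. *)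
Lemma order_independence_size_eq :
  #|G| = independence_number G + size_graph G ->
  forall v w w', adj v w -> adj v w' -> w = w'.
Proof.
have [O oriO] := orientation_exists; rewrite (size_graph_orientation oriO).
move=> cardG v w w' vw vw'.
(* An edge at [v] is represented by [v] whichever way it is oriented, any other edge by its first
   end. *)
pose pick_end (p : G * G) := if p.2 == v then v else p.1.
have : #|O| <= #|[set pick_end p | p in O]|.
  rewrite -(leq_add2l (independence_number G)) -cardG.
  apply: order_le_independence_hitting => a b /(adj_orientation oriO).
  case/orP=> /(imset_f pick_end); rewrite /pick_end /=;
    by case: eqP => [->|_] ->; rewrite ?orbT.
rewrite leq_eqVlt ltnNge leq_imset_card orbF eq_sym => /imset_injP pick_inj.
have edge_at a : adj v a ->
    exists2 p, p \in O & pick_end p = v /\ [set p.1; p.2] = [set v; a].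
  move=> va; have aNv : a != v.
    by apply: contraTneq va => ->; rewrite adj_irrefl.
  case/orP: (adj_orientation oriO va) => pO.
    by exists (v, a); rewrite /pick_end //= (negPf aNv).
  by exists (a, v); rewrite /pick_end //= eqxx setUC.
have [p pO [pv pw]] := edge_at w vw; have [p' pO' [pv' pw']] := edge_at w' vw'.
have epp : p = p' by apply: pick_inj; rewrite // pv pv'.
have : w \in [set v; w'] by rewrite -pw' -epp pw set22.
rewrite !inE => /orP[]/eqP// ewv.
by rewrite ewv adj_irrefl in vw.
Qed.

(** Every vertex is isolated or an end of exactly one oriented edge; enumerating [O] and the
    isolated set [I] gives the parametrization [g]. *)
Lemma matching_isolated_of_unique_neighbour :
  (forall v w w', adj v w -> adj v w' -> w = w') ->
  exists k, isomorphic G (matching_isolated (size_graph G) k).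
Proof.
move=> uniq_nb; have [O oriO] := orientation_exists.
rewrite (size_graph_orientation oriO).
pose I := [set v : G | [forall w, ~~ adj v w]]; exists #|I|.
pose fin (p : G * G) (b : bool) := if b then p.2 else p.1.
have fin_adj p b : p \in O -> adj (fin p b) (fin p (~~ b)).
  case: p => v w /(orientation_adj oriO) vw.
  by case: b; rewrite /fin //= adj_sym.
have fin_inj p p' b b' : p \in O -> p' \in O -> fin p b = fin p' b' ->
    p = p' /\ b = b'.
  move=> pO pO' E.
  (* The opposite ends are neighbours of one vertex, hence equal; antisymmetry of [O] then excludes
     the reversed pair. *)
  have E' : fin p (~~ b) = fin p' (~~ b').
    by apply: uniq_nb (fin_adj _ _ pO) _; rewrite E fin_adj.
  case: p p' pO pO' E E' => [v w] [v' w'] pO pO'.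
  case: b b' => [] [] /=; rewrite /fin /= => e1 e2; subst v' w' => //;
    by rewrite (orientation_antisym oriO pO) in pO'.
have isol v w : v \in I -> adj v w = false.
  by rewrite inE => /forallP/(_ w)/negPf.
pose g (u : matching_isolated #|O| #|I|) : G :=
  match u with inl (i, b) => fin (enum_val i) b | inr j => enum_val j end.
have finI (i : 'I_#|O|) b (j : 'I_#|I|) : fin (enum_val i) b <> enum_val j.
  move=> E; have := fin_adj _ b (enum_valP i).
  by rewrite E isol //; apply: enum_valP.
have g_inj : injective g.
  move=> [[i b]|i] [[j c]|j] /= E.
  - have [/enum_val_inj-> ->] := fin_inj _ _ _ _ (enum_valP i) (enum_valP j) E.
    by [].
  - by case: (finI _ _ _ E).
  - by case: (finI _ _ _ (esym E)).
  - by rewrite (enum_val_inj E).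
apply: (isomorphic_of_parametrization g_inj) => [v|[[i b]|i] [[j c]|j]] /=.
- have [vI|] := boolP (v \in I).
    by exists (inr (enum_rank_in vI v)); rewrite /= enum_rankK_in.
  rewrite inE => /forallPn[w]; rewrite negbK => /(adj_orientation oriO).
  case/orP=> pO.
    by exists (inl (enum_rank_in pO (v, w), false)); rewrite /= enum_rankK_in.
  by exists (inl (enum_rank_in pO (w, v), true)); rewrite /= enum_rankK_in.
- apply/idP/andP => [ij|[/eqP-> bc]].
    have /fin_inj[] := uniq_nb _ _ _ (fin_adj _ b (enum_valP i)) ij.
    + exact: enum_valP.
    + exact: enum_valP.
    + by move=> /enum_val_inj-> <-; case: (b).
  by have -> : c = ~~ b; [case: b c bc => [] [] | apply/fin_adj/enum_valP].
- by rewrite adj_sym isol //; apply: enum_valP.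
- by rewrite isol //; apply: enum_valP.
- by rewrite isol //; apply: enum_valP.
Qed.

(** When [X] and [~: X] are colour classes, this is both an orientation and the set of pairs to
    which [konig] applies. *)
Definition crossing_edges X : {set G * G} :=
  [set p | [&& p.1 \in X, p.2 \notin X & adj p.1 p.2]].

(** * Bipartite graphs with colour classes [X] and [~: X] *)

Section Bipartition.
Variable X : {set G}.
Hypotheses (indX : independent X) (indXc : independent (~: X)).

Lemma bipartition_adj v w : adj v w -> (v \in X) != (w \in X).
Proof.
move=> vw; case vX: (v \in X); case wX: (w \in X) => //.
  by have /forall_inP/(_ v vX)/forall_inP/(_ w wX) := indX; rewrite vw.
have /forall_inP/(_ v) := indXc; rewrite inE vX => /(_ isT)/forall_inP/(_ w).
by rewrite inE wX vw => /(_ isT).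
Qed.

Lemma crossing_edges_orientation : orientation (crossing_edges X).
Proof.
move=> v w; rewrite !inE /= (adj_sym w); case vw: (adj v w); last by rewrite !andbF.
by have := bipartition_adj vw; case: (v \in X); case: (w \in X).
Qed.

(** Crossing edges form a subset of the product of the classes. The equality case later yields
    completeness of [induced B]. *)
Lemma bipartition_size_leqif :
  size_graph G <= #|X| * #|~: X|
    ?= iff [forall v in X, forall w in ~: X, adj v w].
Proof.
rewrite (size_graph_orientation crossing_edges_orientation) -cardsX.
have sub : crossing_edges X \subset setX X (~: X).
  by apply/subsetP=> -[v w]; rewrite !inE /= => /and3P[-> ->].
have [le_card eq_card] := subset_leqif_cards sub; split=> //; rewrite eq_card.
apply/eqP/forall_inP => [E v vX|H].
  apply/forall_inP => w wX; have : (v, w) \in setX X (~: X) by rewrite inE /= vX.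
  by rewrite -E inE => /and3P[].
apply/setP=> -[v w]; rewrite !inE /=; case vX: (v \in X) => //=.
case wX: (w \in X) => //=; have /forall_inP/(_ w) := H v vX.
by rewrite inE wX => /(_ isT).
Qed.

Lemma isomorphic_complete_bipartite :
  (forall v w, v \in X -> w \notin X -> adj v w) ->
  isomorphic G (complete_bipartite #|X| #|~: X|).
Proof.
move=> full; have full' v w : v \notin X -> w \in X -> adj v w.
  by move=> vX wX; rewrite adj_sym full.
pose g (u : complete_bipartite #|X| #|~: X|) : G :=
  match u with inl i => enum_val i | inr j => enum_val j end.
have gX i : g (inl i) \in X by apply: enum_valP.
have gXc j : g (inr j) \notin X by rewrite -in_setC; apply: enum_valP.
have sameF v w : (v \in X) = (w \in X) -> adj v w = false.
  by move=> E; apply: contra_eqF E => /bipartition_adj.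
apply: (@isomorphic_of_parametrization _ _ g) => [[i|i] [j|j] E|v|[i|i] [j|j]].
- by congr inl; apply: enum_val_inj E.
- by have := gXc j; rewrite -E gX.
- by have := gXc i; rewrite E gX.
- by congr inr; apply: enum_val_inj E.
- have [vX|] := boolP (v \in X).
    by exists (inl (enum_rank_in vX v)); rewrite /= enum_rankK_in.
  rewrite -in_setC => vX.
  by exists (inr (enum_rank_in vX v)); rewrite /= enum_rankK_in.
- by apply: sameF; rewrite !gX.
- by apply: full; [apply: gX | apply: gXc].
- by apply: full'; [apply: gXc | apply: gX].
- by apply: sameF; rewrite !(negPf (gXc _)).
Qed.

Lemma order_le_independence_matching :
  #|G| <= independence_number G + matching_number G.
Proof.
have [M [C [ME M1 M2 covC leC]]] := konig (crossing_edges X).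
have oriE := crossing_edges_orientation.
apply: (@leq_trans (independence_number G + #|C.1 :|: C.2|)).
  apply: order_le_independence_hitting => v w /(adj_orientation oriE).
  by case/orP => /(vertex_coverP _ _ covC)/orP[]; rewrite !inE => ->; rewrite ?orbT.
rewrite leq_add2l; apply: leq_trans (leq_trans (leq_card_setU _ _) leC) _.
have MX v w : (v, w) \in M -> [/\ v \in X, w \notin X & adj v w].
  by move=> /(subsetP ME); rewrite inE => /and3P.
(* A vertex of [X] occurs only as a first end and one outside [X] only as a second end, so
   injectivity of both projections makes distinct edges of [M] disjoint. *)
have same_end p p' a : p \in M -> p' \in M ->
    a \in [set p.1; p.2] -> a \in [set p'.1; p'.2] -> p = p'.
  case: p p' => [v w] [v' w'] pM pM'; rewrite !inE /=.
  have [vX wX _] := MX _ _ pM; have [vX' wX' _] := MX _ _ pM'.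
  case/orP=> /eqP-> /orP[]/eqP e.
  - exact: M1.
  - by rewrite -e vX in wX'.
  - by rewrite e vX' in wX.
  - exact: M2.
have <- : #|[set [set p.1; p.2] | p in M]| = #|M|.
  apply: card_in_imset => p p' pM pM' E.
  by apply: (same_end p p' p.1); rewrite // -?E set21.
apply: (bigmax_sup [set [set p.1; p.2] | p in M]) => //; apply/andP; split.
  apply/subsetP => _ /imsetP[[v w] /MX[_ _ vw] ->].
  by apply: imset_f; rewrite inE.
apply/trivIsetP => _ _ /imsetP[p pM ->] /imsetP[p' pM' ->] ne.
apply/pred0P => a /=; apply: contraNF ne => /andP[ap ap'].
by rewrite (same_end p p' a).
Qed.
End Bipartition.

End Orientation.

(** * Induced subgraphs and degree sums *)

Section InducedSubgraphs.
Variable G : sgraph.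
Implicit Types (A B S X : {set G}).

Lemma card_induced S : #|induced S| = #|S|.
Proof. by rewrite card_sig; apply: eq_card. Qed.

Lemma handshake_induced S :
  \sum_(v in S) \sum_(w in S) adj v w = 2 * size_graph (induced S).
Proof.
rewrite -handshake big_sub; apply: eq_bigr => v _.
by rewrite big_sub.
Qed.

Lemma independent_induced X S :
  independent X -> independent [set u : induced S | val u \in X].
Proof.
move=> /forall_inP indX; apply/forall_inP => u; rewrite inE => uX.
apply/forall_inP => u'; rewrite inE => uX'.
by have /forall_inP/(_ _ uX') := indX _ uX.
Qed.

Lemma independence_number_induced S :
  independence_number (induced S) <= independence_number G.
Proof.
apply/bigmax_leqP => T /forall_inP indT.
rewrite -(card_imset T val_inj); apply: bigmax_sup => //.
apply/forall_inP => _ /imsetP[u uT ->]; apply/forall_inP => _ /imsetP[u' uT' ->].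
by have /forall_inP/(_ _ uT') := indT _ uT.
Qed.

(** The degree sum over [A] counts edges inside [A] twice and edges leaving [A] once. Comparing it
    with the total number of edges cancels one copy of the former and all of the latter. *)
Lemma annihilating_size_induced A :
  annihilating A -> size_graph (induced A) <= size_graph (induced (~: A)).
Proof.
rewrite /annihilating => annA; pose D (S T : {set G}) := \sum_(v in S) \sum_(w in T) adj v w.
have splitD S : \sum_(v in S) \sum_(w : G) adj v w = D S A + D S (~: A).
  rewrite -big_split; apply: eq_bigr => v _ /=; rewrite (bigID (mem A)) /=.
  by congr (_ + _); apply: eq_bigl => w; rewrite inE.
have degA : \sum_(v in A) degree v = D A A + D A (~: A).
  rewrite -splitD; apply: eq_bigr => v _; rewrite /degree -sum1dep_card big_mkcond.
  by apply: eq_bigr => w _; case: (adj v w).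
have total : D A A + D A (~: A) + (D (~: A) A + D (~: A) (~: A)) = 2 * size_graph G.
  rewrite -!splitD -handshake [RHS](bigID (mem A)) /=.
  by congr (_ + _); apply: eq_bigl => w; rewrite inE.
have symD : D (~: A) A = D A (~: A).
  rewrite /D exchange_big /=; apply: eq_bigr => v _; apply: eq_bigr => w _.
  by rewrite adj_sym.
have := handshake_induced A; have := handshake_induced (~: A).
rewrite -!/(D _ _); lia.
Qed.
End InducedSubgraphs.

(** * The extremal equation and its equality cases *)

(** With [s] the square root of [1 + mu], the equation says [x = (s - 1)^2], so
    [mu - x = 2 (s - 1)], and squaring eliminates [s]. The hypothesis makes the subtraction
    exact. *)
Lemma extremal_equation_nat (R : rcfType) (G : sgraph) :
  annihilation_gap G <= matching_number G ->
  extremal_equation R G ->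
  4 * annihilation_gap G = (matching_number G - annihilation_gap G) ^ 2.
Proof.
rewrite /extremal_equation -natrB ?independence_le_annihilation //.
rewrite -/(annihilation_gap G).
move: (annihilation_gap G) (matching_number G) => x mu lex eq_x.
have sq : (Num.sqrt (1 + mu%:R) ^+ 2 = 1 + mu%:R :> R)%R.
  by rewrite sqr_sqrtr // addr_ge0 ?ler01 ?ler0n.
apply/eqP; rewrite -(eqr_nat R) natrM natrX natrB //; apply/eqP.
by move: (Num.sqrt _) sq eq_x => s sq eq_x; nra.
Qed.

Theorem proposition4p2 (R : rcfType) (G : sgraph) (Gbip : bipartite G) :
  (forall A B : {set G}, annihilating_decomposition A B ->
     extremal_equation R G ->
     exists q : nat,
       [/\ 1 + matching_number G = q ^ 2,
           (q%:R = Num.sqrt (1 + (matching_number G)%:R) :> R)%R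
         & extremal_structure A B q])
  /\
  ((exists (A B : {set G}) (q : nat),
      [/\ annihilating_decomposition A B, 2 <= q & extremal_structure A B q]) ->
   extremal_equation R G).
Proof.
have sqrt_mu (q : nat) : 1 + matching_number G = q ^ 2 ->
    (Num.sqrt (1 + (matching_number G)%:R) = q%:R :> R)%R.
  by move=> mu1; rewrite nat1r -add1n mu1 natrX sqrtr_sqr ger0_norm ?ler0n.
split=> [A _ [annA cardA ->] eqn|[A [B [q [_ q2 [[mu_q x_q _] _]]]]]]; last first.
  (* Converse: with [q] as the root, the claim is [(q - 1)^2 = 2 + (q^2 - 1) - 2 q]; [2 <= q] keeps
     the natural subtractions exact. *)
  rewrite /extremal_equation -natrB ?independence_le_annihilation //.
  rewrite -/(annihilation_gap G) x_q.
  have mu1 : (1 + matching_number G = q ^ 2)%N by rewrite mu_q; lia.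
  rewrite (sqrt_mu _ mu1).
  have -> : ((matching_number G)%:R = q%:R ^+ 2 - 1 :> R)%R.
    by rewrite -natrX -mu1 natrD addrAC subrr add0r.
  by rewrite natrX natrB; [ring | lia].
case: Gbip => X /andP[indX indXc].
set B := ~: A.
pose P := [set u : induced B | val u \in X].
have indP : independent P by apply: independent_induced.
have indPc : independent (~: P).
  have -> : ~: P = [set u : induced B | val u \in ~: X] by apply/setP => u; rewrite !inE.
  exact: independent_induced.
have [leB eqB] := bipartition_size_leqif indP indPc.
have cardP : #|P| + #|~: P| = #|B| by rewrite cardsC card_induced.
have leA := order_le_independence_size (induced A); rewrite card_induced in leA.
have leAB := annihilating_size_induced annA.
have le_alpha := independence_number_induced A.
have konigG := order_le_independence_matching indX indXc.
have := cardsC A; rewrite -/B => cardG.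
have gapE : annihilation_number G = independence_number G + annihilation_gap G.
  by rewrite subnKC // independence_le_annihilation.
have := extremal_equation_nat _ eqn; rewrite -/B in leAB *.
(* Since [#|A|] is the independence number plus the gap, [konigG] bounds the gap plus [#|B|] by the
   matching number. *)
have gap_le : annihilation_gap G <= matching_number G by lia.
move=> /(_ gap_le) eqx.
have [eP eq_mu eq_gap] : [/\ #|P| = #|~: P|,
    matching_number G = annihilation_gap G + 2 * #|P| &
    annihilation_gap G = #|P| * #|~: P|].
  have le_x : annihilation_gap G <= #|P| * #|~: P| by lia.
  have le_P : #|P| + #|~: P| <= matching_number G - annihilation_gap G by lia.
  move: eqx le_x le_P gap_le; clear.
  move: (annihilation_gap G) (matching_number G) #|P| #|~: P| => x mu p p'.
  move=> eqx le_x le_P gap_le.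
  have {}eqx : 4 * x = (mu - x) * (mu - x) by [].
  have le_sq := leq_mul le_P le_P.
  (* [(p + p')^2 <= 4 x <= 4 p p'] leaves [(p - p')^2 <= 0]. Once [p = p'], both bounds are tight:
     [x = p^2] and [mu - x = 2 p]. *)
  have epp : p = p' by nia.
  subst p'; split=> //; nia.
have full : forall v w, v \in P -> w \notin P -> adj v w.
  (* The chain from [x] through [e(A)] and [e(B)] to the product of the class sizes now starts and
     ends at the same value. *)
  have : size_graph (induced B) == #|P| * #|~: P| by apply/eqP; lia.
  rewrite eqB => /forall_inP H v w /H/forall_inP/(_ w); rewrite inE; apply.
(* For [p = #|P|], [mu = p^2 + 2 p], which dictates the witness [q = p + 1]. *)
have mu1 : 1 + matching_number G = (#|P| + 1) ^ 2 by lia.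
exists (#|P| + 1); split.
- exact: mu1.
- by rewrite (sqrt_mu _ mu1).
split; first by split; lia.
have eA : size_graph (induced A) = annihilation_gap G by lia.
split.
- exact: eA.
- lia.
- have := isomorphic_complete_bipartite indP indPc full.
  by rewrite -eP addnK.
(* From [#|A| = alpha(G) + x] and [e(A) = x], the bound [leA] gives [alpha(G) <= alpha(G[A])]; with
   [le_alpha] this is equality, so [leA] is tight. *)
- rewrite -eA; apply: matching_isolated_of_unique_neighbour.
  apply: order_independence_size_eq; rewrite card_induced; lia.
- lia.
Qed.
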